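(* There exists a constant $C>0$ such that the following is true. Let $0<\epsilon<1/2$ and let $G$ be a finite abelian group of odd order with $|G|\ge \mathrm{tower}(C\log(1/\epsilon))$. For every $A\subset G$, setting $\alpha=|A|/|G|$, there exists some $d\in G\setminus\{0\}$ such that $x,x+d,x+2d\in A$ for at least $(\alpha^3-\epsilon)|G|$ many values of $x\in G$.
   Context: $\mathrm{tower}(m)$ denotes an exponential tower of twos of height $m$: $\mathrm{tower}(0)=1$ and $\mathrm{tower}(m+1)=2^{\mathrm{tower}(m)}$ for integers $m\ge 0$; for a real number $x\ge 0$, $\mathrm{tower}(x)$ means $\mathrm{tower}(\lfloor x\rfloor)$. $\log$ is the natural logarithm (the base is immaterial up to changing the constant). *)

(* Defs.v *)
From HB Require Import structures.
From mathcomp Require Import all_boot all_order all_algebra.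
From mathcomp Require Import reals exp.

Set Implicit Arguments.
Unset Strict Implicit.
Unset Printing Implicit Defensive.

Import Order.TTheory GRing.Theory Num.Theory.
Local Open Scope ring_scope.

Fixpoint tower_nat (m : nat) : nat :=
  if m is m'.+1 then (2 ^ tower_nat m')%N else 1%N.

(* [Num.truncn] is the floor, as a natural number, on nonnegative arguments;
   the (irrelevant) value for x < 0 is [tower_nat 0]. *)
Definition tower (R : realType) (x : R) : nat := tower_nat (Num.truncn x).

Definition density (R : realType) (G : finZmodType) (A : {set G}) : R :=
  #|A|%:R / #|G|%:R.

Definition ap3_starts (G : finZmodType) (A : {set G}) (d : G) : {set G} :=
  [set x | [&& x \in A, x + d \in A & x + d *+ 2 \in A]].

(* Main.v *)
Require Import Defs.
From HB Require Import structures.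
From mathcomp Require Import all_boot all_order all_algebra.
From mathcomp Require Import reals exp.
From mathcomp Require Import ring lra zify.

Set Implicit Arguments.
Unset Strict Implicit.
Unset Printing Implicit Defensive.

Import Order.TTheory GRing.Theory Num.Theory.
Local Open Scope ring_scope.

(** The argument takes place in physical space. Let [f] be the indicator of [A],
    [corr] its autocorrelation, and [shiftnorm s] the L1 distance between [corr]
    and its translate by [s]; this is an even subadditive function, whose balls
    play the role of Bohr sets. A sampling argument bounds the size of its balls
    from below, uniformly in [A].

    Let [b r] be the mean cube of the average of [f] over a window of radius [r];
    it lies between [alpha ^+ 3] and [1]. For [r'' << r' << r], replacing [f] by
    its average [g] at scale [r''] hardly changes the count of progressions whose
    difference is distributed as the difference of two points of a window of
    radius [r'] (Cauchy-Schwarz). Schur's inequality applied to each progression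
    shows that the normalized count for [g] is at least [2 * b r - b r''], up to
    a small error. If no difference is popular, this forces
    [b r'' - alpha ^+ 3 >= 2 * (b r - alpha ^+ 3) + eps / 4], so the excess of [b]
    over [alpha ^+ 3] doubles at each step, which can happen only [O(log (1/eps))]
    times. Each new scale is exponential in a power of the previous one, hence
    the tower. *)

(** * Averages *)

Definition avg (R : realFieldType) (T : finType) (h : T -> R) : R :=
  (\sum_x h x) / #|T|%:R.

Notation "''E_' x F" := (avg (fun x => F))
  (at level 34, x at level 1, F at level 41, right associativity, format "''E_' x  F").

Section Average.
Variables (R : realFieldType) (T : finType).
Implicit Types (h g : T -> R) (c : R).

Lemma eq_avg h g : h =1 g -> 'E_x h x = 'E_x g x.
Proof. by move=> hg; rewrite /avg (eq_bigr _ (fun x _ => hg x)). Qed.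

Lemma avgD h g : 'E_x (h x + g x) = 'E_x h x + 'E_x g x.
Proof. by rewrite /avg big_split mulrDl. Qed.

Lemma avgN h : 'E_x (- h x) = - 'E_x h x.
Proof. by rewrite /avg sumrN mulNr. Qed.

Lemma avgB h g : 'E_x (h x - g x) = 'E_x h x - 'E_x g x.
Proof. by rewrite avgD avgN. Qed.

Lemma avgZ c h : 'E_x (c * h x) = c * 'E_x h x.
Proof. by rewrite /avg -mulr_sumr mulrA. Qed.

Lemma avgZr c h : 'E_x (h x * c) = ('E_x h x) * c.
Proof. by rewrite mulrC -avgZ; apply: eq_avg => x; rewrite mulrC. Qed.

Lemma avg_ge0 h : (forall x, 0 <= h x) -> 0 <= 'E_x h x.
Proof. by move=> h0; rewrite divr_ge0 ?ler0n ?sumr_ge0. Qed.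

Lemma ler_avg h g : (forall x, h x <= g x) -> 'E_x h x <= 'E_x g x.
Proof.
by move=> hg; rewrite -subr_ge0 -avgB avg_ge0 // => x; rewrite subr_ge0.
Qed.

Lemma ler_norm_avg h : `|'E_x h x| <= 'E_x `|h x|.
Proof.
by rewrite ler_norml -avgN !ler_avg //= => x; rewrite ?ler_norm // lerNl -normrN ler_norm.
Qed.

Lemma reindex_avg (s : T -> T) h : injective s -> 'E_x h (s x) = 'E_x h x.
Proof. by move=> s_inj; rewrite /avg [in RHS](reindex_inj s_inj). Qed.

End Average.

Lemma exchange_avg (R : realFieldType) (S T : finType) (h : S -> T -> R) :
  'E_x 'E_y h x y = 'E_y 'E_x h x y.
Proof.
by rewrite /avg -!mulr_suml exchange_big /= mulrAC.
Qed.

Section AverageGroup.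
Variables (R : realFieldType) (G : finZmodType).
Implicit Types (h g k : G -> R) (c : R).

Lemma card_zmod_gt0 : 0 < #|G|%:R :> R.
Proof. by rewrite ltr0n; apply/card_gt0P; exists 0. Qed.

Lemma avg_cst c : avg (fun _ : G => c) = c.
Proof.
by rewrite /avg sumr_const -[c *+ _]mulr_natr mulfK ?gt_eqF ?card_zmod_gt0.
Qed.

Lemma avg_le c h : (forall x, h x <= c) -> 'E_x h x <= c.
Proof. by move=> hc; rewrite -[leRHS]avg_cst ler_avg. Qed.

Lemma avg_shift a h : 'E_x h (x + a) = 'E_x h x.
Proof. exact: reindex_avg (addIr a). Qed.

Lemma avg_shiftl a h : 'E_x h (a + x) = 'E_x h x.
Proof. exact: reindex_avg (addrI a). Qed.

Lemma avg_opp h : 'E_x h (- x) = 'E_x h x.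
Proof. exact: reindex_avg oppr_inj. Qed.

Lemma avg_sqr_le h : ('E_x h x) ^+ 2 <= 'E_x h x ^+ 2.
Proof.
set c := 'E_x h x.
have : 0 <= 'E_x (h x - c) ^+ 2 by apply: avg_ge0 => x; apply: sqr_ge0.
rewrite (@eq_avg _ _ _ (fun x => h x ^+ 2 + ((- (2 * c)) * h x + c ^+ 2))).
  rewrite !avgD avg_cst avgZ -/c; lra.
by move=> x; ring.
Qed.

End AverageGroup.

(** * The size of the balls of the shift norm *)

Lemma avg_ex_le (R : realFieldType) (G : finZmodType) (h : G -> R) (c : R) :
  'E_x h x <= c -> exists x, h x <= c.
Proof.
move=> hc; apply/existsP; rewrite -[[exists _, _]]negbK negb_exists.
apply/negP => /forallP hgt.
have : \sum_(x : G) c < \sum_x h x.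
  apply: ltr_sum => [|x _]; first by apply/hasP; exists 0; rewrite ?mem_index_enum.
  by rewrite ltNge.
rewrite sumr_const -[c *+ _]mulr_natr -ltr_pdivlMr ?card_zmod_gt0 // ltNge.
by rewrite -/(avg h) hc.
Qed.

(** Pigeonhole, one sample point at a time: membership of [x - s] in [A] splits the current set in
    two, and the larger class is kept, at the cost of a factor 2. *)
Lemma exists_common_pattern (G : finZmodType) (A : {set G}) (xs : seq G) (S : {set G}) :
  exists S' : {set G}, [/\ S' \subset S, (#|S| <= 2 ^ size xs * #|S'|)%N &
    forall x s s', x \in xs -> s \in S' -> s' \in S' ->
      (x - s \in A) = (x - s' \in A)].
Proof.
elim: xs => [|x xs [S1 [S1S cS1 S1P]]]; first by exists S; rewrite mul1n.
pose Z := [set s | x - s \in A].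
have [le|/ltnW le] := leqP #|S1 :\: Z| #|S1 :&: Z|.
- exists (S1 :&: Z); split.
  + by apply: subset_trans S1S; apply: subsetIl.
  + rewrite expnSr -mulnA (leq_trans cS1) // leq_mul2l -(cardsID Z S1).
    by rewrite mul2n -addnn leq_add2l le orbT.
  + move=> y s s'; rewrite inE => /orP[/eqP->|ys]; rewrite !inE;
      move=> /andP[sS sZ] /andP[sS' sZ'].
      by rewrite sZ sZ'.
    exact: S1P.
- exists (S1 :\: Z); split.
  + by apply: subset_trans S1S; apply: subsetDl.
  + rewrite expnSr -mulnA (leq_trans cS1) // leq_mul2l -(cardsID Z S1).
    by rewrite mul2n -addnn leq_add2r le orbT.
  + move=> y s s'; rewrite inE => /orP[/eqP->|ys]; rewrite !inE;
      move=> /andP[sZ sS] /andP[sZ' sS'].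
      by rewrite (negbTE sZ) (negbTE sZ').
    exact: S1P.
Qed.

Section ShiftNorm.
Variables (R : realFieldType) (G : finZmodType) (A : {set G}).

Definition ind (x : G) : R := (x \in A)%:R.
Definition corr (t : G) : R := 'E_x ind x * ind (x + t).
Definition shiftnorm (s : G) : R := 'E_t `|corr (t + s) - corr t|.

Lemma ind_itv x : 0 <= ind x <= 1.
Proof. by rewrite ler0n lern1 leq_b1. Qed.

Lemma ind_ge0 x : 0 <= ind x. Proof. by case/andP: (ind_itv x). Qed.
Lemma ind_le1 x : ind x <= 1. Proof. by case/andP: (ind_itv x). Qed.

Lemma corr_itv t : 0 <= corr t <= 1.
Proof.
rewrite avg_ge0 => [|x]; last by rewrite mulr_ge0 ?ind_ge0.
by apply: avg_le => x; rewrite mulr_ile1 ?ind_ge0 ?ind_le1.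
Qed.

Lemma shiftnorm_ge0 s : 0 <= shiftnorm s.
Proof. by apply: avg_ge0 => t; apply: normr_ge0. Qed.

Lemma shiftnorm0 : shiftnorm 0 = 0.
Proof.
rewrite /shiftnorm (@eq_avg _ _ _ (fun=> 0)) ?avg_cst // => t.
by rewrite addr0 subrr normr0.
Qed.

Lemma shiftnormN s : shiftnorm (- s) = shiftnorm s.
Proof.
rewrite /shiftnorm -(avg_shift s); apply: eq_avg => t.
by rewrite addrK distrC.
Qed.

Lemma shiftnormD s t : shiftnorm (s + t) <= shiftnorm s + shiftnorm t.
Proof.
rewrite addrC [leRHS]addrC /shiftnorm -[X in _ <= X + _](avg_shift s) -avgD.
by apply: ler_avg => x; rewrite -addrA [s + t]addrC; apply: ler_distD.
Qed.

Lemma shiftnormB s t : shiftnorm (s - t) = 'E_x `|corr (x + s) - corr (x + t)|.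
Proof.
rewrite /shiftnorm -(avg_shift t); apply: eq_avg => x.
by rewrite [s - t]addrC addrA addrK.
Qed.

(** Over a uniform [x] the product [ind (x - s) * ind (x + t)] has mean [corr (t + s)], so each
    sample point contributes an error of mean zero. The sum is not divided by the number of
    points. *)
Definition sampling_error (xs : seq G) (s t : G) : R :=
  \sum_(x <- xs) (corr (t + s) - ind (x - s) * ind (x + t)).

(* Greedy choice of the sample points: averaged over the next point, the cross
   term of the squared error vanishes. *)
Lemma exists_sample k : exists xs : seq G,
  size xs = k /\ 'E_s 'E_t sampling_error xs s t ^+ 2 <= k%:R.
Proof.
elim: k => [|k [xs [szxs xsP]]].
  exists [::]; split=> //; apply: avg_le => s; apply: avg_le => t.
  by rewrite /sampling_error big_nil expr0n.
pose Y x s t := corr (t + s) - ind (x - s) * ind (x + t).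
have EY s t : 'E_x Y x s t = 0.
  rewrite avgB avg_cst -(avg_shift s); apply/eqP; rewrite subr_eq0; apply/eqP.
  by apply: eq_avg => x; rewrite addrK -addrA [s + t]addrC.
have Y1 x s t : Y x s t ^+ 2 <= 1.
  have /andP[a0 a1] := corr_itv (t + s).
  have /andP[b0 b1] := ind_itv (x - s); have /andP[c0 c1] := ind_itv (x + t).
  have d0 : 0 <= ind (x - s) * ind (x + t) by rewrite mulr_ge0.
  have d1 : ind (x - s) * ind (x + t) <= 1 by rewrite mulr_ile1.
  rewrite /Y; nra.
have [x xP] : exists x, 'E_s 'E_t sampling_error (x :: xs) s t ^+ 2 <= k.+1%:R.
  apply: avg_ex_le; rewrite exchange_avg.
  rewrite (@eq_avg _ _ _ (fun s => 'E_t 'E_x sampling_error (x :: xs) s t ^+ 2));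
    last first.
    by move=> s; rewrite exchange_avg.
  rewrite -natr1; apply: le_trans (lerD xsP (lexx _)).
  rewrite -[X in _ <= _ + X](avg_cst G) -avgD; apply: ler_avg => s.
  rewrite -[X in _ <= _ + X](avg_cst G) -avgD; apply: ler_avg => t.
  have := EY s t; set e := sampling_error xs s t => EY0.
  rewrite (@eq_avg _ _ _ (fun x => (e ^+ 2 + (2 * e) * Y x s t) + Y x s t ^+ 2)).
    rewrite 2!avgD avg_cst avgZ EY0 mulr0 addr0 lerD2l; exact: avg_le.
  move=> x; rewrite /sampling_error big_cons -/(sampling_error xs s t).
  by rewrite -/e -/(Y x s t); ring.
by exists (x :: xs); rewrite /= szxs.
Qed.

(** By Markov's inequality at least half of all shifts have squared L1 sampling error at most
    [2 * k]. Among these, shifts with a common pattern at the sample points have the same sampled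
    sums, hence nearly the same translates of [corr]. *)
Lemma exists_close_shifts k : (0 < k)%N -> exists S : {set G},
  (#|G| <= 2 ^ k.+1 * #|S|)%N /\
  forall s s', s \in S -> s' \in S -> k%:R * shiftnorm (s - s') ^+ 2 <= 8.
Proof.
move=> k_gt0; have [xs [szxs xsP]] := exists_sample k.
pose psi s := 'E_t `|sampling_error xs s t|.
have psi0 s : 0 <= psi s by apply: avg_ge0 => t.
have psi2 : 'E_s psi s ^+ 2 <= k%:R.
  apply: le_trans xsP; apply: ler_avg => s; apply: le_trans (avg_sqr_le _) _.
  by apply: ler_avg => t; rewrite real_normK ?num_real.
pose S0 := [set s | psi s ^+ 2 <= 2 * k%:R].
have cS0 : (#|G| <= 2 * #|S0|)%N.
  rewrite -(cardsC S0) mul2n -addnn leq_add2l.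
  have : \sum_(s in ~: S0) (2 * k%:R) + 0 <= \sum_s psi s ^+ 2 :> R.
    rewrite [leRHS](bigID [in ~: S0]) /= lerD // ?sumr_ge0 // => [|s _].
      by apply: ler_sum => s; rewrite !inE -ltNge => /ltW.
    by rewrite sqr_ge0.
  move: psi2; rewrite ler_pdivrMr ?card_zmod_gt0 // => h1 h2.
  have := le_trans h2 h1; rewrite addr0 sumr_const -[_ *+ #|_|]mulr_natr.
  rewrite [2 * _]mulrC -[X in X <= _]mulrA ler_pM2l ?ltr0n //.
  rewrite -natrM ler_nat -(cardsC S0); lia.
have [S [SS0 cS SP]] := exists_common_pattern A xs S0.
exists S; split.
  by rewrite expnS -mulnA (leq_trans cS0) // leq_mul2l -szxs cS.
move=> s s' sS s'S.
have hs : psi s ^+ 2 <= 2 * k%:R by have := subsetP SS0 _ sS; rewrite inE.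
have hs' : psi s' ^+ 2 <= 2 * k%:R by have := subsetP SS0 _ s'S; rewrite inE.
have kphi : k%:R * shiftnorm (s - s') <= psi s + psi s'.
  rewrite shiftnormB -avgZ -avgD; apply: ler_avg => t.
  (* As [ind (x - s) = ind (x - s')] at every sample point, the sampled products cancel. *)
  have -> : k%:R * `|corr (t + s) - corr (t + s')| =
            `|sampling_error xs s t - sampling_error xs s' t|.
    rewrite -[X in X * _]normr_nat -normrM /sampling_error -sumrB; congr `|_|.
    rewrite -szxs -sum1_size natr_sum mulr_suml [LHS]big_seq [RHS]big_seq.
    apply: eq_bigr => x xxs; rewrite /ind (SP _ _ _ xxs sS s'S); ring.
  exact: ler_normB.
have := psi0 s; have := psi0 s'; have := shiftnorm_ge0 (s - s').
have : 0 < k%:R :> R by rewrite ltr0n.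
move: (shiftnorm _) (psi s) (psi s') k%:R hs hs' kphi => p a b K.
move=> ha hb h K0 p0 b0 a0.
(* Here [(a + b) ^+ 2 <= 2 * (a ^+ 2 + b ^+ 2) <= 8 * K]. *)
have : (K * p) ^+ 2 <= 8 * K.
  apply: (@le_trans _ _ ((a + b) ^+ 2)); last by nra.
  by rewrite lerXn2r ?nnegrE ?addr_ge0 ?mulr_ge0 // ltW.
rewrite exprMn expr2 -mulrA mulrC ler_pM2r //.
Qed.

End ShiftNorm.

(** * Smoothing by windows *)

Section WeightedMean.
Variables (R : realFieldType) (G : finZmodType).
Implicit Types (k g h : G -> R) (c : R).

Definition wmean k g : R := ('E_s k s * g s) / 'E_s k s.

Lemma eq_wmean k g h : g =1 h -> wmean k g = wmean k h.
Proof. by move=> gh; congr (_ / _); apply: eq_avg => s; rewrite gh. Qed.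

Lemma exchange_wmean_avg k (h : G -> G -> R) :
  'E_x wmean k (h x) = wmean k (fun s => 'E_x h x s).
Proof.
rewrite /wmean avgZr exchange_avg; congr (_ / _).
by apply: eq_avg => s; rewrite -avgZ.
Qed.

Lemma exchange_wmean k k' (h : G -> G -> R) :
  wmean k (fun x => wmean k' (h x)) = wmean k' (fun s => wmean k (h^~ s)).
Proof.
rewrite /wmean.
under eq_avg do rewrite mulrA.
rewrite avgZr.
under [in RHS]eq_avg do rewrite mulrA.
rewrite avgZr mulrAC; congr (_ / _ / _).
under eq_avg do rewrite -avgZ.
rewrite exchange_avg; apply: eq_avg => s; rewrite -avgZ; apply: eq_avg => x.
by rewrite mulrCA.
Qed.

Section Weight.
Variable k : G -> R.
Hypotheses (k_ge0 : forall s, 0 <= k s) (k_mass : 0 < 'E_s k s).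

Lemma wmean_cst c : wmean k (fun=> c) = c.
Proof. by rewrite /wmean avgZr mulrAC mulfV ?mul1r ?gt_eqF. Qed.

Lemma ler_wmean g h : (forall s, k s != 0 -> g s <= h s) ->
  wmean k g <= wmean k h.
Proof.
move=> gh; rewrite ler_pM2r ?invr_gt0 //; apply: ler_avg => s.
have [->|ks] := eqVneq (k s) 0; first by rewrite !mul0r.
by rewrite ler_wpM2l // gh.
Qed.

Lemma wmeanD g h : wmean k (fun s => g s + h s) = wmean k g + wmean k h.
Proof.
by rewrite /wmean -mulrDl -avgD; congr (_ / _); apply: eq_avg => s; rewrite mulrDr.
Qed.

Lemma wmeanZ c g : wmean k (fun s => c * g s) = c * wmean k g.
Proof.
by rewrite /wmean mulrA -avgZ; congr (_ / _); apply: eq_avg => s; rewrite mulrCA.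
Qed.

Lemma wmeanN g : wmean k (fun s => - g s) = - wmean k g.
Proof. by rewrite -mulN1r -wmeanZ; apply: eq_wmean => s; rewrite mulN1r. Qed.

Lemma wmean_itv g : (forall s, 0 <= g s <= 1) -> 0 <= wmean k g <= 1.
Proof.
move=> g01; rewrite -{1}(wmean_cst 0) -[X in _ && (_ <= X)](wmean_cst 1).
by rewrite !ler_wmean // => s _; case/andP: (g01 s).
Qed.

Lemma wmean_dist g c e : (forall s, k s != 0 -> `|g s - c| <= e) ->
  `|wmean k g - c| <= e.
Proof.
move=> ge; rewrite ler_distl -[c - e]wmean_cst -[c + e]wmean_cst.
apply/andP; split; apply: ler_wmean => s ks; have := ge s ks;
  by rewrite ler_distl => /andP[].
Qed.

(** The mean of the tangent line inequality [g s ^+ 2 >= 2 * w * g s - w ^+ 2], taken at the mean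
    [w]. *)
Lemma wmean_sqr g : wmean k g ^+ 2 <= wmean k (fun s => g s ^+ 2).
Proof.
set w := wmean k g.
have : wmean k (fun s => (2 * w) * g s + - w ^+ 2) <= wmean k (fun s => g s ^+ 2).
  by apply: ler_wmean => s _; have := sqr_ge0 (g s - w); nra.
by rewrite wmeanD wmeanZ wmean_cst -/w; nra.
Qed.

Lemma wmean_cube g : (forall s, 0 <= g s) ->
  wmean k g ^+ 3 <= wmean k (fun s => g s ^+ 3).
Proof.
move=> g0; set w := wmean k g.
have w0 : 0 <= w by rewrite -(wmean_cst 0); apply: ler_wmean.
(* The tangent line inequality [t^3 >= w^3 + 3 w^2 (t - w)] for [t, w >= 0]. *)
have : wmean k (fun s => (3 * w ^+ 2) * g s + (- 2) * w ^+ 3) <=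
    wmean k (fun s => g s ^+ 3).
  apply: ler_wmean => s _; rewrite -subr_ge0; move: (w) w0 => u u0.
  have -> : g s ^+ 3 - (3 * u ^+ 2 * g s + - 2 * u ^+ 3) = (g s - u) ^+ 2 * (g s + 2 * u).
    by ring.
  by rewrite mulr_ge0 ?sqr_ge0 // addr_ge0 // mulr_ge0.
by rewrite wmeanD wmeanZ wmean_cst -/w; nra.
Qed.

End Weight.

Lemma avg_cube g : (forall s, 0 <= g s) -> ('E_s g s) ^+ 3 <= 'E_s g s ^+ 3.
Proof.
move=> g0; have E1 : avg (fun _ : G => 1 : R) = 1 by apply: avg_cst.
have wE h : wmean (fun _ : G => 1) h = 'E_s h s.
  by rewrite /wmean E1 divr1; apply: eq_avg => s; rewrite mul1r.
have := @wmean_cube (fun=> 1) (fun=> ler01) _ g g0; rewrite E1 !wE; apply.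
exact: ltr01.
Qed.

End WeightedMean.

Lemma cube_dist (R : realFieldType) (a b e : R) :
  0 <= a <= 1 -> 0 <= b <= 1 -> `|a - b| <= e -> b ^+ 3 <= a ^+ 3 + 3 * e.
Proof.
move=> /andP[a0 a1] /andP[b0 b1]; rewrite ler_distl => /andP[h1 h2].
have e0 : 0 <= e by lra.
have c0 : 0 <= b ^+ 2 + b * a + a ^+ 2 by nra.
have c3 : b ^+ 2 + b * a + a ^+ 2 <= 3 by nra.
have -> : b ^+ 3 = a ^+ 3 + (b - a) * (b ^+ 2 + b * a + a ^+ 2) by ring.
nra.
Qed.

(** * Tent windows of a subadditive function and smoothing by them *)

Section Window.
Variables (R : realFieldType) (G : finZmodType) (phi : G -> R).
Hypotheses (phi_ge0 : forall s, 0 <= phi s) (phi0 : phi 0 = 0)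
  (phiN : forall s, phi (- s) = phi s)
  (phiD : forall s t, phi (s + t) <= phi s + phi t).
Implicit Types (f g : G -> R) (r : R).

(** A tent rather than the indicator of a ball: it is Lipschitz with respect to [phi] at every
    radius, whereas the size of a ball may jump. *)
Definition window r s : R := Num.max 0 (1 - phi s / r).
Definition smooth r f x : R := wmean (window r) (fun s => f (x + s)).
Definition cube_mean r f : R := 'E_x smooth r f x ^+ 3.

Lemma window_ge0 r s : 0 <= window r s.
Proof. by rewrite le_max lexx. Qed.

Lemma window_le1 r s : 0 < r -> window r s <= 1.
Proof. by move=> r0; rewrite ge_max ler01 gerBl divr_ge0 // ltW. Qed.

Lemma window_supp r s : 0 < r -> window r s != 0 -> phi s <= r.
Proof.
move=> r0; apply: contraR; rewrite -ltNge => rs.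
by apply/eqP/max_idPl; rewrite subr_le0 ler_pdivlMr // mul1r ltW.
Qed.

Lemma window_lipschitz r s w : 0 < r ->
  `|window r (s + w) - window r s| <= phi w / r.
Proof.
move=> r0.
have h1 : phi (s + w) / r <= phi s / r + phi w / r.
  by rewrite -mulrDl ler_pM2r ?invr_gt0.
have h2 : phi s / r <= phi (s + w) / r + phi w / r.
  by rewrite -mulrDl ler_pM2r ?invr_gt0 // -{1}(addrK w s) -(phiN w).
have h3 : 0 <= phi w / r by rewrite divr_ge0 // ltW.
rewrite ler_distl /window; move: (phi s / r) (phi _ / r) (phi w / r) h1 h2 h3 => a b c.
by case: (leP 0 (1 - a)) => ?; case: (leP 0 (1 - b)) => ?; lra.
Qed.

Lemma window_mass_gt0 r : 0 < 'E_s window r s.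
Proof.
rewrite divr_gt0 ?card_zmod_gt0 // (bigD1 0) //= ltr_wpDr ?sumr_ge0 // => [s _|].
  exact: window_ge0.
by rewrite /window phi0 mul0r subr0 lt_max ltr01 orbT.
Qed.

Hint Resolve window_ge0 window_mass_gt0 : core.

Lemma smooth_itv r f : (forall x, 0 <= f x <= 1) -> forall x, 0 <= smooth r f x <= 1.
Proof. by move=> f01 x; apply: wmean_itv. Qed.

Lemma avg_smooth r f : 'E_x smooth r f x = 'E_x f x.
Proof.
rewrite exchange_wmean_avg -[RHS](wmean_cst (window_mass_gt0 r)).
by apply: eq_wmean => s; rewrite avg_shift.
Qed.

Lemma cube_mean_ge r f : (forall x, 0 <= f x <= 1) -> ('E_x f x) ^+ 3 <= cube_mean r f.
Proof.
move=> f01; rewrite -(avg_smooth r); apply: avg_cube => x.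
by case/andP: (smooth_itv r f01 x).
Qed.

Lemma cube_mean_le1 r f : (forall x, 0 <= f x <= 1) -> cube_mean r f <= 1.
Proof.
move=> f01; apply: avg_le => x.
by have /andP[? ?] := smooth_itv r f01 x; rewrite exprn_ile1.
Qed.

Lemma cube_mean_jensen r f : (forall x, 0 <= f x) -> cube_mean r f <= 'E_x f x ^+ 3.
Proof.
move=> f0; have -> : 'E_x f x ^+ 3 = 'E_x smooth r (fun x => f x ^+ 3) x.
  by rewrite avg_smooth.
by apply: ler_avg => x; apply: wmean_cube.
Qed.

(** The shift by [w] is moved from [f] to the window, which changes by at most [phi w / r] at each
    point; normalization then divides by the mass. *)
Lemma smooth_lipschitz r f x w : 0 < r -> (forall x, 0 <= f x <= 1) ->
  `|smooth r f (x + w) - smooth r f x| <= phi w / (r * 'E_s window r s).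
Proof.
move=> r0 f01; rewrite /smooth /wmean.
rewrite -(avg_shift (- w)) -mulrBl -avgB.
rewrite [_ / (r * _)](_ : _ = phi w / r / 'E_s window r s); last first.
  by rewrite invfM mulrA.
rewrite normrM.
rewrite [`|_^-1|]gtr0_norm ?invr_gt0 // ler_pM2r ?invr_gt0 //.
apply: le_trans (ler_norm_avg _) _; apply: avg_le => s.
have -> : x + w + (s - w) = x + s by rewrite addrACA subrr addr0.
rewrite -mulrBl normrM -[leRHS]mulr1 ler_pM //.
  by rewrite -(phiN w) window_lipschitz.
by have /andP[? ?] := f01 (x + s); rewrite ger0_norm.
Qed.

(* By Jensen, further averaging at scale [r] only decreases the mean cube, and
   it absorbs the finer averages up to its modulus of continuity. The case
   [c = 2] serves the pair of outer terms of a progression. *)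
Lemma cube_mean_dilated_window r r' r'' f c :
  0 < r -> 0 < r' -> 0 < r'' -> r'' <= r' -> (c <= 2)%N ->
  (forall x, 0 <= f x <= 1) ->
  cube_mean r f - 9 * r' / (r * 'E_s window r s) <=
  'E_v wmean (window r') (fun p => smooth r'' f (v + p *+ c)) ^+ 3.
Proof.
move=> r0 r0' r0'' le_r c2 f01.
set D := _ * 'E_s window r s; have D0 : 0 < D by rewrite mulr_gt0.
set W := fun v => wmean (window r') (fun p => smooth r'' f (v + p *+ c)).
have W01 v : 0 <= W v <= 1 by apply: wmean_itv => // p; apply: smooth_itv.
apply: (@le_trans _ _ (cube_mean r W)); last first.
  by apply: cube_mean_jensen => v; case/andP: (W01 v).
rewrite lerBlDr -(avg_cst G (9 * r' / D)) -avgD; apply: ler_avg => x.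
(* One factor 3 is the Lipschitz constant of the cube on the unit interval; the other comes from
   [phi (p *+ c + s) <= 2 * r' + r'' <= 3 * r']. *)
rewrite (_ : 9 * r' / D = 3 * (3 * r' / D)); last by ring.
apply: cube_dist; [exact: smooth_itv|exact: smooth_itv|].
(* Averages over shifts commute, so the coarse average may be taken innermost; its value is then
   only needed near [x]. *)
have -> : smooth r W x = wmean (window r') (fun p =>
    wmean (window r'') (fun s => smooth r f (x + (p *+ c + s)))).
  rewrite /smooth /W exchange_wmean; apply: eq_wmean => p.
  rewrite exchange_wmean; apply: eq_wmean => s.
  by apply: eq_wmean => t; congr f; rewrite -!addrA; congr (_ + _); rewrite addrC addrA.
apply: wmean_dist => // p /(window_supp r0') pr'.
apply: wmean_dist => // s /(window_supp r0'') sr''.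
apply: le_trans (smooth_lipschitz _ _ r0 f01) _; rewrite ler_pM2r ?invr_gt0 //.
apply: le_trans (phiD _ _) _.
have : phi (p *+ c) <= 2 * r'.
  case: c c2 {W W01} => [|[|[|//]]] _; rewrite ?mulr0n ?mulr1n ?mulr2n ?phi0; try lra.
  by apply: le_trans (phiD _ _) _; lra.
lra.
Qed.

End Window.

(** * Weighted counts of three-term progressions *)

Lemma mulrn_card (G : finZmodType) (z : G) : z *+ #|G| = 0.
Proof.
have : \sum_(x : G) (x + z) = \sum_(x : G) x by rewrite [RHS](reindex_inj (addIr z)).
by rewrite big_split sumr_const -[RHS]addr0 => /addrI.
Qed.

(** An element killed both by 2 and by the odd order of the group is zero. *)
Lemma zmod_double_inj (G : finZmodType) : odd #|G| -> injective (fun x : G => x *+ 2).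
Proof.
move=> oddG x y /eqP; rewrite -subr_eq0 -mulrnBl => /eqP dxy.
apply/eqP; rewrite -subr_eq0; move: (x - y) dxy => z dz.
have := mulrn_card z; rewrite -[#|G|]odd_double_half oddG -mul2n mulrnDr mulrnA dz.
by rewrite mul0rn addr0 => /eqP.
Qed.

Section ProgressionForm.
Variables (R : realFieldType) (G : finZmodType) (k : G -> R).
Implicit Types (a b c g h : G -> R) (F : G -> G -> G -> R).

(** Up to the factor [('E_u k u) ^+ 2], the density of the difference of two independent points
    distributed according to [k]. *)
Definition overlap d : R := 'E_u k u * k (u + d).

Definition ap_form F : R := 'E_x 'E_d overlap d * F x (x + d) (x + d *+ 2).

Lemma eq_ap_form F F' : (forall x y z, F x y z = F' x y z) -> ap_form F = ap_form F'.
Proof. by move=> FF'; apply: eq_avg => x; apply: eq_avg => d; rewrite FF'. Qed.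

Lemma ap_formD F F' :
  ap_form (fun x y z => F x y z + F' x y z) = ap_form F + ap_form F'.
Proof.
rewrite -avgD; apply: eq_avg => x; rewrite -avgD; apply: eq_avg => d.
by rewrite mulrDr.
Qed.

Lemma ap_formZ (t : R) F : ap_form (fun x y z => t * F x y z) = t * ap_form F.
Proof.
rewrite -avgZ; apply: eq_avg => x; rewrite -avgZ; apply: eq_avg => d.
by rewrite mulrCA.
Qed.

Lemma overlapN d : overlap (- d) = overlap d.
Proof.
rewrite /overlap -(avg_shift d); apply: eq_avg => u.
by rewrite addrK mulrC.
Qed.

Lemma avg_overlap : 'E_d overlap d = ('E_u k u) ^+ 2.
Proof.
rewrite exchange_avg expr2 -avgZr; apply: eq_avg => u.
by rewrite avgZ avg_shiftl.
Qed.

(** Replacing [x] by [x + d *+ 2] and [d] by [- d] reverses each progression, and the weight is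
    even. *)
Lemma ap_form_rev F : ap_form (fun x y z => F z y x) = ap_form F.
Proof.
rewrite /ap_form exchange_avg [RHS]exchange_avg -avg_opp; apply: eq_avg => d.
rewrite -(avg_shift (d *+ 2)); apply: eq_avg => x.
rewrite overlapN mulNrn addrK; congr (_ * F _ _ _).
by rewrite mulr2n addrA addrK.
Qed.

Lemma ap_form_1 h : ap_form (fun x _ _ => h x) = ('E_u k u) ^+ 2 * 'E_x h x.
Proof.
rewrite -avg_overlap -avgZ; apply: eq_avg => x.
by rewrite avgZr.
Qed.

Lemma ap_form_2 h : ap_form (fun _ y _ => h y) = ('E_u k u) ^+ 2 * 'E_x h x.
Proof.
rewrite -avg_overlap -avgZr /ap_form exchange_avg; apply: eq_avg => d.
by rewrite avgZ avg_shift.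
Qed.

Lemma ap_form_3 h : ap_form (fun _ _ z => h z) = ('E_u k u) ^+ 2 * 'E_x h x.
Proof. by rewrite -(ap_form_1 h) -[RHS]ap_form_rev. Qed.

(* In this form functions of the first and second terms absorb the weight, so
   that it does not obstruct Cauchy-Schwarz. *)
Lemma ap_form_split12 F : ap_form F =
  'E_u 'E_p 'E_q k (p + u) * k (q + u) * F p q (q *+ 2 - p).
Proof.
rewrite exchange_avg; apply: eq_avg => p.
rewrite exchange_avg /ap_form -[LHS](avg_shift (- p)); apply: eq_avg => q.
rewrite avgZr; congr (_ * F _ _ _).
- rewrite /overlap -[LHS](avg_shift p); apply: eq_avg => u.
  by rewrite [p + u]addrC [q + u]addrC -addrA [p + (q - p)]addrC subrK.
- by rewrite addrC subrK.
- by rewrite mulrnBl [p *+ 2]mulr2n opprD addrCA [p + _]addrA subrr add0r.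
Qed.

(* The substitution [x = 2 p], [x + 2 d = 2 q] does the same for the first and
   third terms. *)
Lemma ap_form_split13 F : odd #|G| -> ap_form F =
  'E_u 'E_p 'E_q k (p + u) * k (q + u) * F (p *+ 2) (p + q) (q *+ 2).
Proof.
move=> oddG; rewrite exchange_avg /ap_form -(reindex_avg _ (zmod_double_inj oddG)).
apply: eq_avg => p; rewrite exchange_avg -[LHS](avg_shift (- p)); apply: eq_avg => q.
rewrite avgZr; congr (_ * F _ _ _).
- rewrite /overlap -[LHS](avg_shift p); apply: eq_avg => u.
  by rewrite [p + u]addrC [q + u]addrC -addrA [p + (q - p)]addrC subrK.
- by rewrite mulr2n -addrA [p + (q - p)]addrC subrK.
- by rewrite mulrnDl mulNrn addrC subrK.
Qed.

End ProgressionForm.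

(** * The cost of smoothing the indicator in a progression count *)

Section SmoothingError.
Variables (R : realFieldType) (G : finZmodType).

(* Cauchy-Schwarz eliminates [b], then the shift [t] between two values of [p]
   is equidistributed. *)
Lemma bilinear_sqr_le (sg tau : G -> G) (a b h : G -> R) :
  injective sg -> injective tau ->
  (forall x, `|a x| <= 1) -> (forall x, `|b x| <= 1) ->
  ('E_p 'E_q a p * b q * h (sg q + tau p)) ^+ 2 <= 'E_t `|'E_z h z * h (z + t)|.
Proof.
move=> sg_inj tau_inj a1 b1; set Q := fun t => 'E_z h z * h (z + t).
pose H q := 'E_p a p * h (sg q + tau p).
have -> : 'E_p 'E_q a p * b q * h (sg q + tau p) = 'E_q b q * H q.
  rewrite exchange_avg; apply: eq_avg => q; rewrite -avgZ.
  by apply: eq_avg => p; rewrite mulrCA mulrA.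
apply: le_trans (avg_sqr_le _) _; apply: (@le_trans _ _ ('E_q H q ^+ 2)).
  apply: ler_avg => q; rewrite exprMn ler_piMl ?sqr_ge0 //.
  by rewrite -real_normK ?num_real // exprn_ile1.
(* After expansion of the square, the substitution [z = sg q + tau p] turns the average over [q]
   into an autocorrelation of [h]. *)
have -> : 'E_q H q ^+ 2 = 'E_p 'E_p' a p * a p' * Q (tau p' - tau p).
  rewrite (@eq_avg _ _ _ (fun q =>
      'E_p 'E_p' a p * a p' * (h (sg q + tau p) * h (sg q + tau p')))).
    rewrite exchange_avg; apply: eq_avg => p; rewrite exchange_avg; apply: eq_avg => p'.
    rewrite avgZ; congr (_ * _).
    rewrite (reindex_avg (fun z => h (z + tau p) * h (z + tau p')) sg_inj) /Q.
    rewrite -(avg_shift (tau p)); apply: eq_avg => z.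
    by rewrite -addrA [tau p + _]addrC subrK.
  move=> q; rewrite expr2 {1}/H -avgZr; apply: eq_avg => p; rewrite /H -avgZ.
  by apply: eq_avg => p'; rewrite mulrACA.
apply: avg_le => p.
have <- : 'E_p' `|Q (tau p' - tau p)| = 'E_t `|Q t|.
  rewrite (reindex_avg (fun t => `|Q (t - tau p)|) tau_inj).
  exact: (avg_shift (- tau p) (fun t => `|Q t|)).
apply: ler_avg => p'; apply: le_trans (ler_norm _) _.
by rewrite normrM ler_piMl // normrM mulr_ile1.
Qed.

Hypothesis oddG : odd #|G|.
Variable A : {set G}.
Local Notation f := (ind R A).
Local Notation phi := (shiftnorm R A).

(** The autocorrelation of [f z - f (z + s)] is, up to sign, the sum of the increments of [corr] by
    [s] and by [- s], each of L1 norm [phi s]. *)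
Lemma shift_error (sg tau : G -> G) (a b : G -> R) s :
  injective sg -> injective tau ->
  (forall x, `|a x| <= 1) -> (forall x, `|b x| <= 1) ->
  ('E_p 'E_q a p * b q * (f (sg q + tau p) - f (sg q + tau p + s))) ^+ 2
    <= 2 * phi s.
Proof.
move=> sg_inj tau_inj a1 b1.
apply: le_trans (bilinear_sqr_le (fun z => f z - f (z + s)) sg_inj tau_inj a1 b1) _.
rewrite mulr_natl mulr2n -{2}shiftnormN -avgD; apply: ler_avg => t.
have -> : 'E_z (f z - f (z + s)) * (f (z + t) - f (z + t + s)) =
    - (corr R A (t + s) - corr R A t) - (corr R A (t - s) - corr R A t).
  rewrite (@eq_avg _ _ _ (fun z => (f z * f (z + t) - f z * f (z + t + s)) -
     (f (z + s) * f (z + t) - f (z + s) * f (z + t + s)))); last by move=> z; ring.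
  rewrite 3!avgB.
  have -> : 'E_z f z * f (z + t + s) = corr R A (t + s).
    by apply: eq_avg => z; rewrite addrA.
  have -> : 'E_z f (z + s) * f (z + t) = corr R A (t - s).
    by rewrite /corr -[RHS](avg_shift s); apply: eq_avg => z; rewrite addrACA subrr addr0.
  have -> : 'E_z f (z + s) * f (z + t + s) = corr R A t.
    by rewrite /corr -[RHS](avg_shift s); apply: eq_avg => z; rewrite addrAC.
  rewrite -/(corr R A t); ring.
by rewrite -opprD normrN ler_normD.
Qed.

Variables (r eta : R).
Hypotheses (r_gt0 : 0 < r) (eta_ge0 : 0 <= eta) (r_eta : 2 * r <= eta ^+ 2).
Local Notation g := (smooth phi r f).

Let mass_gt0 : 0 < 'E_s window phi r s.
Proof. by apply: window_mass_gt0; apply: shiftnorm0. Qed.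

(** The difference [f - g] is a window mean of the functions [f z - f (z + s)] with [phi s <= r],
    and each of them contributes at most [eta] because [2 * r <= eta ^+ 2]. *)
Lemma smoothing_error (sg tau : G -> G) (a b : G -> R) :
  injective sg -> injective tau ->
  (forall x, `|a x| <= 1) -> (forall x, `|b x| <= 1) ->
  `|'E_p 'E_q a p * b q * (f (sg q + tau p) - g (sg q + tau p))| <= eta.
Proof.
move=> sg_inj tau_inj a1 b1.
have -> : 'E_p 'E_q a p * b q * (f (sg q + tau p) - g (sg q + tau p)) =
  wmean (window phi r) (fun s =>
    'E_p 'E_q a p * b q * (f (sg q + tau p) - f (sg q + tau p + s))).
  rewrite -exchange_wmean_avg; apply: eq_avg => p.
  rewrite -exchange_wmean_avg; apply: eq_avg => q.
  by rewrite wmeanZ wmeanD wmean_cst // wmeanN.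
rewrite -[X in `|X|]subr0; apply: wmean_dist => // [s|s sr]; first exact: window_ge0.
have := shift_error s sg_inj tau_inj a1 b1; rewrite subr0.
set X := avg _ => hX.
rewrite -(@ler_pXn2r _ 2) ?nnegrE // real_normK ?num_real //.
apply: le_trans hX (le_trans _ r_eta).
by rewrite ler_pM2l // (window_supp _ sr).
Qed.

Variable k : G -> R.
Hypothesis k01 : forall x, 0 <= k x <= 1.

Let weighted_le1 (a : G -> R) (w : G -> G) u : (forall x, 0 <= a x <= 1) ->
  forall p, `|k (p + u) * a (w p)| <= 1.
Proof.
move=> a01 p; have /andP[? ?] := k01 (p + u); have /andP[? ?] := a01 (w p).
by rewrite ger0_norm ?mulr_ge0 // mulr_ile1.
Qed.

(** For each [u] the weights [k (p + u)] and [k (q + u)] join the bounded coefficients. The third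
    term is [q *+ 2 - p], and odd order makes doubling injective. *)
Lemma ap_form_error3 (a b : G -> R) :
  (forall x, 0 <= a x <= 1) -> (forall x, 0 <= b x <= 1) ->
  `|ap_form k (fun x y z => a x * b y * (f z - g z))| <= eta.
Proof.
move=> a01 b01; rewrite ap_form_split12; apply: le_trans (ler_norm_avg _) _.
apply: avg_le => u.
have := @smoothing_error (fun q => q *+ 2) -%R (fun p => k (p + u) * a p)
  (fun q => k (q + u) * b q) (zmod_double_inj oddG) oppr_inj
  (weighted_le1 id u a01) (weighted_le1 id u b01).
congr (`|_| <= _); apply: eq_avg => p; apply: eq_avg => q.
by rewrite -!mulrA; congr (_ * _); rewrite mulrCA.
Qed.

(** With outer terms [p *+ 2] and [q *+ 2], the middle term is [p + q]. *)
Lemma ap_form_error2 (a b : G -> R) :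
  (forall x, 0 <= a x <= 1) -> (forall x, 0 <= b x <= 1) ->
  `|ap_form k (fun x y z => a x * (f y - g y) * b z)| <= eta.
Proof.
move=> a01 b01; rewrite ap_form_split13 //; apply: le_trans (ler_norm_avg _) _.
apply: avg_le => u.
have := @smoothing_error (fun q => q) (fun p => p) (fun p => k (p + u) * a (p *+ 2))
  (fun q => k (q + u) * b (q *+ 2)) (@inj_id _) (@inj_id _)
  (weighted_le1 (fun p => p *+ 2) u a01) (weighted_le1 (fun p => p *+ 2) u b01).
congr (`|_| <= _); apply: eq_avg => p; apply: eq_avg => q.
by rewrite [q + p]addrC /=; ring.
Qed.

Lemma ap_form_error1 (a b : G -> R) :
  (forall x, 0 <= a x <= 1) -> (forall x, 0 <= b x <= 1) ->
  `|ap_form k (fun x y z => (f x - g x) * a y * b z)| <= eta.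
Proof.
move=> a01 b01; rewrite -ap_form_rev.
have := ap_form_error3 b01 a01; congr (`|_| <= _); apply: eq_ap_form => x y z.
by ring.
Qed.

(** Telescoping: the three factors are replaced one at a time, each at cost [eta]. *)
Lemma ap_form_smooth :
  ap_form k (fun x y z => g x * g y * g z) - 3 * eta <=
  ap_form k (fun x y z => f x * f y * f z).
Proof.
have f01 := ind_itv R A.
have g01 : forall x, 0 <= g x <= 1.
  by apply: smooth_itv => //; apply: shiftnorm0.
have -> : ap_form k (fun x y z => f x * f y * f z) =
    ap_form k (fun x y z => g x * g y * g z) +
    (ap_form k (fun x y z => (f x - g x) * f y * f z) +
    (ap_form k (fun x y z => g x * (f y - g y) * f z) +
     ap_form k (fun x y z => g x * g y * (f z - g z)))).
  by rewrite -!ap_formD; apply: eq_ap_form => x y z; ring.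
have := ap_form_error1 f01 f01; have := ap_form_error2 g01 f01.
have := ap_form_error3 g01 g01.
by rewrite !ler_norml => /andP[? _] /andP[? _] /andP[? _]; lra.
Qed.

End SmoothingError.

(** * Schur's inequality *)

Lemma schur_sorted (R : realFieldType) (a b c : R) : 0 <= c -> c <= b -> b <= a ->
  a ^+ 2 * b + a * b ^+ 2 + (a ^+ 2 * c + a * c ^+ 2) + (b ^+ 2 * c + b * c ^+ 2) <=
  3 * (a * b * c) + (a ^+ 3 + b ^+ 3 + c ^+ 3).
Proof.
move=> c0 cb ba; rewrite -subr_ge0.
set X := (X in 0 <= X).
have -> : X = (a - b) ^+ 2 * (a + b - c) + c * ((a - c) * (b - c)) by rewrite /X; ring.
by rewrite addr_ge0 ?mulr_ge0 ?sqr_ge0 // ; lra.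
Qed.

Lemma schur (R : realFieldType) (a b c : R) : 0 <= a -> 0 <= b -> 0 <= c ->
  a ^+ 2 * b + a * b ^+ 2 + (a ^+ 2 * c + a * c ^+ 2) + (b ^+ 2 * c + b * c ^+ 2) <=
  3 * (a * b * c) + (a ^+ 3 + b ^+ 3 + c ^+ 3).
Proof.
move=> a0 b0 c0.
by case: (leP a b) => ab; case: (leP b c) => bc; case: (leP a c) => ac;
  (try have := schur_sorted a0 ab bc); (try have := schur_sorted a0 ac (ltW bc));
  (try have := schur_sorted b0 (ltW ab) ac); (try have := schur_sorted b0 bc (ltW ac));
  (try have := schur_sorted c0 (ltW ac) ab);
  (try have := schur_sorted c0 (ltW bc) (ltW ab)); lra.
Qed.

Section Schur.
Variables (R : realFieldType) (G : finZmodType) (k g : G -> R).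
Hypotheses (oddG : odd #|G|) (k_ge0 : forall x, 0 <= k x) (mass_gt0 : 0 < 'E_u k u)
  (g01 : forall x, 0 <= g x <= 1).
Local Notation m := ('E_u k u).

Lemma ap_form_12 (a b : G -> R) : ap_form k (fun x y _ => a x * b y) =
  'E_u ('E_p k (p + u) * a p) * ('E_q k (q + u) * b q).
Proof.
rewrite ap_form_split12; apply: eq_avg => u; rewrite -avgZr; apply: eq_avg => p.
by rewrite -avgZ; apply: eq_avg => q; rewrite mulrACA.
Qed.

Lemma ap_form_13 (a b : G -> R) : ap_form k (fun x _ z => a x * b z) =
  'E_u ('E_p k (p + u) * a (p *+ 2)) * ('E_q k (q + u) * b (q *+ 2)).
Proof.
rewrite ap_form_split13 //; apply: eq_avg => u; rewrite -avgZr; apply: eq_avg => p.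
by rewrite -avgZ; apply: eq_avg => q; rewrite mulrACA.
Qed.

(** Both inner averages are [m] times a window mean around the same point [(- u) *+ c], and the mean
    of a square dominates the square of the mean. The case [c = 1] serves the first two terms of a
    progression, [c = 2] the outer two. *)
Lemma window_pair_ge (c : nat) : injective (fun x : G => x *+ c) ->
  m ^+ 2 * 'E_v wmean k (fun p => g (v + p *+ c)) ^+ 3 <=
  'E_u ('E_p k (p + u) * g (p *+ c) ^+ 2) * ('E_q k (q + u) * g (q *+ c)).
Proof.
move=> c_inj; rewrite -(reindex_avg (fun v => wmean k (fun p => g (v + p *+ c)) ^+ 3) c_inj).
rewrite -(avg_opp (fun u => wmean k (fun p => g (u *+ c + p *+ c)) ^+ 3)) -avgZ.
apply: ler_avg => u.
have shift (h : G -> R) : 'E_p k (p + u) * h (p *+ c) =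
    m * wmean k (fun p => h ((- u) *+ c + p *+ c)).
  rewrite /wmean mulrCA mulfV ?gt_eqF // mulr1 -[LHS](avg_shift (- u)).
  by apply: eq_avg => p; rewrite subrK -mulrnDl addrC.
rewrite shift (shift (fun x => g x ^+ 2)) [leRHS]mulrACA -[m * m]expr2.
rewrite ler_pM2l ?exprn_gt0 // exprSr ler_wpM2r ?wmean_sqr //.
by have /andP[] := wmean_itv k_ge0 mass_gt0 (fun p => g01 ((- u) *+ c + p *+ c)).
Qed.

(** In Schur's inequality each of the six mixed terms contributes at least [m ^+ 2 * B], and each of
    the three cubes exactly [m ^+ 2 * 'E_x g x ^+ 3]; the bound follows on dividing by 3. *)
Lemma schur_ap_form (B : R) :
  (forall c, (0 < c <= 2)%N -> B <= 'E_v wmean k (fun p => g (v + p *+ c)) ^+ 3) ->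
  m ^+ 2 * (2 * B - 'E_x g x ^+ 3) <= ap_form k (fun x y z => g x * g y * g z).
Proof.
move=> B_le.
have m2 : 0 <= m ^+ 2 by rewrite exprn_ge0 // ltW.
have B1 := ler_wpM2l m2 (B_le 1%N isT); have B2 := ler_wpM2l m2 (B_le 2%N isT).
have P1 := le_trans B1 (window_pair_ge (c := 1) (fun x y h => h)).
have P2 := le_trans B2 (window_pair_ge (zmod_double_inj oddG)).
have D12 : m ^+ 2 * B <= ap_form k (fun x y _ => g x ^+ 2 * g y).
  by rewrite (ap_form_12 (fun x => g x ^+ 2) g).
have D21 : m ^+ 2 * B <= ap_form k (fun x y _ => g x * g y ^+ 2).
  apply: le_trans P1 _; rewrite (ap_form_12 g (fun x => g x ^+ 2)).
  by apply: ler_avg => u; rewrite [X in _ <= X]mulrC.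
have D13 : m ^+ 2 * B <= ap_form k (fun x _ z => g x ^+ 2 * g z).
  by rewrite (ap_form_13 (fun x => g x ^+ 2) g).
have D31 : m ^+ 2 * B <= ap_form k (fun x _ z => g x * g z ^+ 2).
  apply: le_trans P2 _; rewrite (ap_form_13 g (fun x => g x ^+ 2)).
  by apply: ler_avg => u; rewrite [X in _ <= X]mulrC.
(* Reversal reduces the last two terms of a progression to the first two. *)
have D32 : m ^+ 2 * B <= ap_form k (fun _ y z => g y * g z ^+ 2).
  rewrite -ap_form_rev; apply: le_trans D12 _.
  by rewrite le_eqVlt; apply/orP; left; apply/eqP/eq_ap_form => x y z; rewrite mulrC.
have D23 : m ^+ 2 * B <= ap_form k (fun _ y z => g y ^+ 2 * g z).
  rewrite -ap_form_rev; apply: le_trans D21 _.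
  by rewrite le_eqVlt; apply/orP; left; apply/eqP/eq_ap_form => x y z; rewrite mulrC.
have g0 x : 0 <= g x by case/andP: (g01 x).
have : ap_form k (fun x y z => g x ^+ 2 * g y + g x * g y ^+ 2 +
      (g x ^+ 2 * g z + g x * g z ^+ 2) + (g y ^+ 2 * g z + g y * g z ^+ 2)) <=
    ap_form k (fun x y z => 3 * (g x * g y * g z) + (g x ^+ 3 + g y ^+ 3 + g z ^+ 3)).
  apply: ler_avg => x; apply: ler_avg => d; rewrite ler_wpM2l ?schur //.
  by apply: avg_ge0 => u; rewrite mulr_ge0.
rewrite !ap_formD ap_formZ (ap_form_1 _ (fun x => g x ^+ 3)).
rewrite (ap_form_2 _ (fun x => g x ^+ 3)) (ap_form_3 _ (fun x => g x ^+ 3)).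
by lra.
Qed.
End Schur.

(** * The increment step and its iteration *)

Section Increment.
Variables (R : realFieldType) (G : finZmodType) (A : {set G}).
Hypothesis oddG : odd #|G|.
Local Notation f := (ind R A).
Local Notation phi := (shiftnorm R A).
Local Notation mass r := ('E_s window phi r s).
Local Notation alpha := ('E_x f x).
Local Notation b := (fun r => cube_mean phi r f).

(** A translate of the set of close shifts lies in the ball of radius [r / 2], since 32 is 4 times
    the 8 bounding close shifts. There the window is at least 1/2, whence the passage from [k.+1] to
    [k.+2]. *)
Lemma mass_lower_bound (r : R) (k : nat) : 0 < r -> (0 < k)%N ->
  32 <= k%:R * r ^+ 2 -> 1 <= 2 ^+ k.+2 * mass r.
Proof.
move=> r0 k0 kr; have [S [cS SP]] := exists_close_shifts R A k0.
have S_gt0 : (0 < #|S|)%N.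
  rewrite lt0n; apply: contraTneq cS => ->; rewrite muln0 -ltnNge.
  by apply/card_gt0P; exists 0.
have /card_gt0P[s0 s0S] := S_gt0.
have half s : s \in S -> 1 / 2 <= window phi r (s - s0).
  move=> sS; have := SP s s0 sS s0S; have := shiftnorm_ge0 R A (s - s0).
  rewrite /window; move: (phi _) => p p0 kp.
  have K0 : 0 < k%:R :> R by rewrite ltr0n.
  have pr : p <= r / 2.
    rewrite -(@ler_pXn2r _ 2) ?nnegrE //; last by lra.
    rewrite -(ler_pM2l K0); apply: le_trans kp _; rewrite expr_div_n; lra.
  rewrite le_max; apply/orP; right.
  have : p / r <= 1 / 2 by rewrite ler_pdivrMr //; lra.
  lra.
have sumS : #|S|%:R / 2 <= \sum_s window phi r s.
  rewrite (reindex_inj (addIr (- s0))) (bigID [in S]) /= ler_wpDr ?sumr_ge0 //.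
    by move=> s _; apply: window_ge0.
  apply: (@le_trans _ _ (\sum_(s in S) (1 / 2))); last exact: ler_sum.
  by rewrite sumr_const -[_ *+ #|S|]mulr_natr; lra.
have n0 := card_zmod_gt0 R G.
rewrite /avg mulrA ler_pdivlMr // mul1r.
move: cS; rewrite -(ler_nat R) natrM natrX => /le_trans; apply.
by rewrite [2 ^+ k.+2]exprSr -[leRHS]mulrA ler_pM2l ?exprn_gt0 //; lra.
Qed.

Definition ap_density d : R := 'E_x f x * f (x + d) * f (x + d *+ 2).

(** The zero difference escapes the bound [c]; its density is at most 1 and its weight at most
    ['E_u k u], whence the last term. *)
Lemma ap_form_le (k : G -> R) (c : R) : (forall x, 0 <= k x <= 1) -> 0 <= c ->
  (forall d, d != 0 -> ap_density d <= c) ->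
  ap_form k (fun x y z => f x * f y * f z) <=
  c * ('E_u k u) ^+ 2 + ('E_u k u) / #|G|%:R.
Proof.
move=> k01 c0 Tc; have ov0 d : 0 <= overlap k d.
  apply: avg_ge0 => u; have /andP[? _] := k01 u; have /andP[? _] := k01 (u + d).
  by rewrite mulr_ge0.
have ov_le : overlap k 0 <= 'E_u k u.
  apply: ler_avg => u; have /andP[? ?] := k01 u; rewrite addr0; exact: ler_piMl.
have T1 d : ap_density d <= 1.
  apply: avg_le => x; rewrite !mulr_ile1 ?mulr_ge0 ?ind_ge0 ?ind_le1 //.
rewrite /ap_form exchange_avg.
apply: (@le_trans _ _ ('E_d (c * overlap k d + (d == 0)%:R * overlap k 0))).
  apply: ler_avg => d; rewrite avgZ -/(ap_density d).
  have [->|d0] := eqVneq d 0.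
    by rewrite mulr1n mul1r; have := mulr_ge0 c0 (ov0 0);
      have := ler_piMr (ov0 0) (T1 0); lra.
  by rewrite mul0r addr0 mulrC ler_wpM2r // Tc.
rewrite avgD avgZ avg_overlap avgZr lerD2l.
have -> : 'E_d (d == 0 :> G)%:R = #|G|%:R^-1 :> R.
  by rewrite /avg (bigD1 0) //= eqxx big1 ?addr0 ?mul1r // => d /negbTE->.
by rewrite mulrC ler_pM2r ?invr_gt0 ?card_zmod_gt0.
Qed.

(** After division by [mass r' ^+ 2], the dilated windows cost [2 * (eps / 16)], the smoothing
    [3 * (eps / 24)] and the zero difference [eps / 2]. Of the deficit [eps] there remains
    [eps / 4]. *)
Lemma cube_mean_increment (eps r r' r'' : R) :
  0 < eps -> 0 < r -> 0 < r' -> 0 < r'' -> r'' <= r' ->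
  144 * r' <= eps * r * mass r ->
  2 * r'' <= ((mass r') ^+ 2 * eps / 24) ^+ 2 ->
  2 <= eps * mass r' * #|G|%:R ->
  0 <= alpha ^+ 3 - eps ->
  (forall d, d != 0 -> ap_density d <= alpha ^+ 3 - eps) ->
  2 * (b r - alpha ^+ 3) + eps / 4 <= b r'' - alpha ^+ 3.
Proof.
move=> eps0 r0 r0' r0'' le_r H1 H2 H3 c0 Tc.
have mass_gt0 t : 0 < mass t by apply: window_mass_gt0; apply: shiftnorm0.
have m0 := mass_gt0 r'; set m := mass r' in H2 H3 m0.
have f01 := ind_itv R A.
have k01 x : 0 <= window phi r' x <= 1.
  by rewrite window_ge0 /= window_le1 //; apply: shiftnorm_ge0.
have m2 : 0 < m ^+ 2 by rewrite exprn_gt0.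
have eta0 : 0 <= m ^+ 2 * eps / 24 by apply: divr_ge0 => //; apply/ltW/mulr_gt0.
have up := ap_form_le k01 c0 Tc; rewrite -/m in up.
have low := ap_form_smooth oddG A r0'' eta0 H2 k01.
have g01 := smooth_itv (shiftnorm0 R A) r'' f01.
have sch := schur_ap_form oddG (window_ge0 phi r') (mass_gt0 r') g01
  (B := b r - 9 * r' / (r * mass r)).
have {}sch : m ^+ 2 * (2 * (b r - 9 * r' / (r * mass r)) - b r'') <=
    ap_form (window phi r') (fun x y z =>
      smooth phi r'' f x * smooth phi r'' f y * smooth phi r'' f z).
  apply: sch => c /andP[_ c2]; apply: cube_mean_dilated_window => //.
  - exact: shiftnorm_ge0.
  - exact: shiftnorm0.
  - exact: shiftnormN.
  - exact: shiftnormD.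
have theta : 9 * r' / (r * mass r) <= eps / 16.
  rewrite ler_pdivrMr; last exact: mulr_gt0 r0 (mass_gt0 r).
  have -> : eps / 16 * (r * mass r) = eps * r * mass r / 16 by ring.
  lra.
have small : m / #|G|%:R <= m ^+ 2 * (eps / 2).
  rewrite ler_pdivrMr ?card_zmod_gt0 //.
  have -> : m ^+ 2 * (eps / 2) * #|G|%:R = m * (eps * m * #|G|%:R / 2) by ring.
  by rewrite ler_peMr ?(ltW m0) //; lra.
have theta2 := ler_wpM2l (ltW m2) theta.
rewrite -subr_ge0 -(pmulr_rge0 _ m2).
move: theta2 sch low up small; move: (m ^+ 2) (9 * r' / _) => M t; lra.
Qed.

End Increment.

(* Scales are the exponents [a] of radii [2 ^- a]. A window of radius [2 ^- a]
   has mass at least [2 ^- (2 ^ (2 * a + 6))], which dictates the next scale. *)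
Definition next_scale (a : nat) : nat := (2 ^ (4 * a))%N.
Definition scale (e i : nat) : nat := iter i next_scale (e + 10)%N.

(** The exponential term is four times the exponent [2 ^ (2 * a + 6)] of the mass bound, as a step
    requires; [3 * a] absorbs the terms linear in [e] and [a], since [e + 10 <= a] at every
    scale. *)
Lemma next_scale_ge (a : nat) : (10 <= a -> 3 * a + 2 ^ (2 * a + 8) <= next_scale a)%N.
Proof.
move=> a10; rewrite /next_scale.
have h : (a < 2 ^ (2 * a))%N.
  by apply: leq_trans (ltn_expl a (ltnSn 1)) _; rewrite leq_exp2l; lia.
have h1 : (2 ^ (2 * a + 9) <= 2 ^ (4 * a))%N by rewrite leq_exp2l //; lia.
have h2 : (2 ^ (2 * a + 8) = 256 * 2 ^ (2 * a))%N by rewrite expnD mulnC.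
have h3 : (2 ^ (2 * a + 9) = 512 * 2 ^ (2 * a))%N by rewrite expnD mulnC.
lia.
Qed.

Lemma scale_ge e i : (e + 10 <= scale e i)%N.
Proof.
elim: i => [//|i IH]; rewrite /scale iterS -/(scale e i).
by have := @next_scale_ge (scale e i); lia.
Qed.

Lemma scaleS e i : scale e i.+1 = next_scale (scale e i).
Proof. by []. Qed.

Lemma leq_scale e i j : (i <= j)%N -> (scale e i <= scale e j)%N.
Proof.
move=> /subnK <-; elim: (j - i)%N => [//|k IH]; apply: leq_trans IH _.
rewrite addSn scaleS; have := scale_ge e (k + i).
have := @next_scale_ge (scale e (k + i)); lia.
Qed.

Lemma leq_tower_nat m n : (m <= n)%N -> (tower_nat m <= tower_nat n)%N.
Proof.
move=> /subnK <-; elim: (n - m)%N => [//|k IH]; apply: leq_trans IH _.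
by rewrite addSn /= ltnW // ltn_expl.
Qed.

Lemma tower_nat_ge m : (m <= tower_nat m)%N.
Proof. by elim: m => //= m IH; apply: leq_trans (ltn_expl _ (ltnSn 1)); rewrite ltnS. Qed.

Lemma mul4_le_exp a : (4 <= a -> 4 * a <= 2 ^ a)%N.
Proof.
elim: a => // a IH; rewrite leq_eqVlt => /orP[/eqP <- //|lt].
by rewrite expnS; have := IH lt; lia.
Qed.

(** As [4 * a <= 2 ^ a], one scale costs two levels of the tower. *)
Lemma scale_tower e i : (scale e i <= tower_nat (e + 10 + 2 * i))%N.
Proof.
elim: i => [|i IH]; first by rewrite muln0 addn0 tower_nat_ge.
rewrite scaleS mulnS addnCA add2n /= leq_exp2l //.
apply: leq_trans (_ : 2 ^ scale e i <= _)%N; last by rewrite leq_exp2l.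
by apply: mul4_le_exp; have := scale_ge e i; lia.
Qed.

(** * Iteration of the increment along dyadic radii *)

Section Iteration.
Variables (R : realFieldType) (G : finZmodType) (A : {set G}) (eps : R) (e : nat).
Hypotheses (oddG : odd #|G|) (eps_gt0 : 0 < eps) (eps_lt1 : eps < 1)
  (eps_ge : 2^-1 ^+ e <= eps).
Local Notation f := (ind R A).
Local Notation phi := (shiftnorm R A).
Local Notation alpha := ('E_x f x).
Local Notation q n := (2^-1 ^+ n : R).

Let q_gt0 n : 0 < q n. Proof. by rewrite exprn_gt0 ?invr_gt0. Qed.

Let q_ge0 n : 0 <= q n. Proof. exact: ltW. Qed.

Let q_le m n : (m <= n)%N -> q n <= q m.
Proof. by move=> mn; rewrite ler_wiXn2l ?invr_ge0 ?invf_le1 ?ler1n. Qed.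

Lemma mass_dyadic a : q (2 ^ (2 * a + 6)) <= 'E_s window phi (q a) s.
Proof.
(* With [k = 2 ^ (2 * a + 5)] the product [k * q a ^+ 2] is exactly 32, and [k.+2 <= 2 * k] gives
   the exponent. *)
have k0 : (0 < 2 ^ (2 * a + 5))%N by rewrite expn_gt0.
have k32 : 32 <= (2 ^ (2 * a + 5))%:R * q a ^+ 2.
  rewrite natrX exprD mulnC exprM exprVn.
  have t0 : (2 : R) ^+ a != 0 by rewrite expf_neq0 ?pnatr_eq0.
  rewrite le_eqVlt; apply/orP; left; apply/eqP; field.
  exact: t0.
have := mass_lower_bound A (q_gt0 a) k0 k32.
set k := (2 ^ _)%N; set M := 'E_s _ => kM.
apply: (@le_trans _ _ (q k.+2)).
  apply: q_le; rewrite addnS expnS -/k.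
  suff : (2 ^ 1 <= k)%N by lia.
  by rewrite leq_exp2l //; lia.
by rewrite exprVn -[leLHS]mul1r ler_pdivrMr ?exprn_gt0 // mulrC.
Qed.

(** The size conditions of the increment, read on exponents: the constants 8, 11 and 1 come from
    [144 <= 2 ^ 8], [2 * 24 ^ 2 <= 2 ^ 11] and the factor 2 in the condition on the order of the
    group. *)
Lemma dyadic_increment a a' a'' l :
  (8 + (e + a + 2 ^ (2 * a + 6)) <= a')%N ->
  (11 + (2 * e + 4 * 2 ^ (2 * a' + 6)) <= a'')%N ->
  (1 + (e + 2 ^ (2 * a' + 6)) <= l)%N -> (2 ^ l <= #|G|)%N ->
  0 <= alpha ^+ 3 - eps ->
  (forall d, d != 0 -> ap_density R A d <= alpha ^+ 3 - eps) ->
  2 * (cube_mean phi (q a) f - alpha ^+ 3) + eps / 4 <=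
  cube_mean phi (q a'') f - alpha ^+ 3.
Proof.
move=> ha ha' hl cG c0 Tc.
have M1 := mass_dyadic a; have M2 := mass_dyadic a'.
have b1 := q_le ha; have b2 := q_le ha'; have b3 := q_le hl.
have nG : 1 <= q l * #|G|%:R.
  rewrite exprVn mulrC ler_pdivlMr ?exprn_gt0 // mul1r -natrX ler_nat //.
apply: (@cube_mean_increment R G A oddG eps (q a) (q a') (q a'')) => //.
- apply: q_le; have : (a' < 2 ^ (2 * a' + 6))%N; last by lia.
  by apply: leq_trans (ltn_expl a' (ltnSn 1)) _; rewrite leq_exp2l; lia.
- move: M1 b1; rewrite 3!exprD; set M := 'E_s _; set L := (2 ^ _)%N => M1 b1.
  have h : q e * q a * q L <= eps * q a * M.
    apply: ler_pM M1; [exact: mulr_ge0|exact: q_ge0|].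
    by apply: ler_wpM2r; first exact: q_ge0.
  have q8 : q 8 = 1 / 256 by rewrite exprVn -natrX div1r.
  have t0 : 0 <= q e * q a * q L by rewrite !mulr_ge0.
  by rewrite q8 in b1; move: b1 h t0;
    move: (q e * q a * q L) (q a') (eps * _ * M) => t u v; lra.
- move: M2 b2; rewrite 2!exprD; set M := 'E_s _; set L := (2 ^ _)%N => M2 b2.
  have h : ((q L) ^+ 2 * q e / 24) ^+ 2 <= (M ^+ 2 * eps / 24) ^+ 2.
    have h1 : q L ^+ 2 <= M ^+ 2.
      by rewrite lerXn2r ?nnegrE ?q_ge0 // (le_trans (q_ge0 L)).
    have h2 : q L ^+ 2 * q e <= M ^+ 2 * eps.
      by apply: ler_pM => //; apply: exprn_ge0 (q_ge0 L).
    have h3 : 0 <= q L ^+ 2 * q e by apply: mulr_ge0 => //; apply: exprn_ge0 (q_ge0 L).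
    by rewrite lerXn2r ?nnegrE; lra.
  have q11 : q 11 = 1 / 2048 by rewrite exprVn -natrX div1r.
  rewrite q11 [(2 * e)%N]mulnC exprM [(4 * L)%N]mulnC exprM in b2.
  move: b2 h; move: (q e) (q L) => x y; move: ((M ^+ 2 * _ / _) ^+ 2) => z.
  have -> : (y ^+ 2 * x / 24) ^+ 2 = (x ^+ 2 * y ^+ 4) / 576 by field.
  have : 0 <= x ^+ 2 * y ^+ 4 by rewrite mulr_ge0 // exprn_even_ge0.
  move: (x ^+ 2 * y ^+ 4) (q a'') => t u; lra.
- move: M2 b3; rewrite 2!exprD expr1; set M := 'E_s _; set L := (2 ^ _)%N => M2 b3.
  have h : q e * q L <= eps * M by apply: ler_pM.
  have n0 := card_zmod_gt0 R G.
  have h2 : 2 * q l <= eps * M.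
    by move: h b3; move: (q e * q L) (q l) (eps * M) => t u v; lra.
  by rewrite -(ler_pM2r n0) in h2; apply: le_trans h2; rewrite -mulrA; lra.
Qed.

(** Each doubling uses two new scales, and after [j] doublings the excess is at least
    [(2 ^+ j - 1) * (eps / 4)]. For [j = e + 3] one has [2 ^+ j * eps >= 8], so the excess is above
    1, which is absurd. *)
Lemma popular_difference :
  (tower_nat (5 * e + 23) <= #|G|)%N -> 0 <= alpha ^+ 3 - eps ->
  ~ (forall d, d != 0 -> ap_density R A d <= alpha ^+ 3 - eps).
Proof.
move=> towG c0 Tc.
have cG : (2 ^ scale e (2 * (e + 3)) <= #|G|)%N.
  apply: leq_trans towG.
  (* The [2 * (e + 3)] scales take two levels each; the last level is the power of 2 compared with
     the order of the group. *)
  have -> : (5 * e + 23 = (e + 10 + 2 * (2 * (e + 3))).+1)%N by lia.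
  by rewrite /= leq_exp2l // scale_tower.
pose b i := cube_mean phi (q (scale e i)) f.
have step j : (j < e + 3)%N ->
    2 * (b (2 * j)%N - alpha ^+ 3) + eps / 4 <= b (2 * j.+1)%N - alpha ^+ 3.
  move=> je; rewrite /b mulnS add2n.
  have g0 := scale_ge e (2 * j); have g1 := scale_ge e (2 * j).+1.
  have n0 := @next_scale_ge (scale e (2 * j)).
  have n1 := @next_scale_ge (scale e (2 * j).+1).
  have lt1 : (scale e (2 * j).+2 <= scale e (2 * (e + 3)))%N by apply: leq_scale; lia.
  have p0 (a : nat) : (2 ^ (2 * a + 8) = 4 * 2 ^ (2 * a + 6))%N.
    by rewrite -[4%N]/(2 ^ 2)%N -expnD; congr (_ ^ _)%N; lia.
  apply: (@dyadic_increment _ (scale e (2 * j).+1) _ (scale e (2 * (e + 3)))) => //.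
  - rewrite scaleS; have := p0 (scale e (2 * j)); lia.
  - rewrite [scale e (2 * j).+2]scaleS; have := p0 (scale e (2 * j).+1); lia.
  - rewrite [scale e (2 * j).+2]scaleS in lt1.
    have := p0 (scale e (2 * j).+1); lia.
have ind j : (j <= e + 3)%N -> (2 ^+ j - 1) * (eps / 4) <= b (2 * j)%N - alpha ^+ 3.
  elim: j => [|j IH] je.
    rewrite expr0 subrr mul0r subr_ge0; apply: cube_mean_ge; first exact: shiftnorm0.
    exact: ind_itv.
  have := step j je; have := IH (ltnW je); rewrite [2 ^+ j.+1]exprS.
  move: (2 ^+ j) => t; nra.
have := ind _ (leqnn _).
have : b (2 * (e + 3))%N <= 1.
  by apply: cube_mean_le1; [exact: shiftnorm0|exact: ind_itv].
have : 8 <= 2 ^+ (e + 3) * eps.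
  have := eps_ge; rewrite exprVn -[X in X <= _]mul1r ler_pdivrMr ?exprn_gt0 // exprD.
  have -> : (2 : R) ^+ 3 = 8 by rewrite -natrX.
  by move: (2 ^+ e) => t; lra.
move: (b _) c0 eps_lt1 eps_gt0; move: (2 ^+ (e + 3)) => t x; nra.
Qed.

End Iteration.

(** * Dyadic approximation of [eps] and conclusion *)

Lemma exists_dyadic (R : realType) (eps : R) : 0 < eps -> eps < 1 / 2 ->
  exists2 e : nat, (2 <= e)%N & 2^-1 ^+ e <= eps < 2^-1 ^+ e.-1.
Proof.
move=> eps0 eps2.
have ex : exists e, 2^-1 ^+ e <= eps.
  exists (Num.truncn eps^-1).+1.
  rewrite exprVn invf_ple ?posrE ?exprn_gt0 // -natrX.
  apply: ltW (lt_le_trans (truncnS_gt _) _).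
  by rewrite ler_nat ltnW // ltn_expl.
case: (ex_minnP ex) => e ee emin; exists e.
  case: e ee {emin} => [|[|//]] ee; exfalso; move: ee; rewrite ?expr0 ?expr1; lra.
rewrite ee /= ltNge; apply/negP => /emin.
case: e ee {emin} => [|e] ee /=; last by rewrite ltnn.
by move: ee; rewrite expr0; lra.
Qed.

Theorem theorem1p4 (R : realType) :
  exists2 C : R, 0 < C &
    forall (eps : R) (G : finZmodType),
      0 < eps -> eps < 1 / 2 ->
      odd #|G| ->
      (tower (C * ln (1 / eps)) <= #|G|)%N ->
      forall A : {set G},
        let alpha : R := density R A in
        exists2 d : G, d != 0 &
          (alpha ^+ 3 - eps) * #|G|%:R <= #|ap3_starts A d|%:R.
Proof.
have ln2 : 0 < ln 2 :> R by rewrite ln_gt0 // ltr1n.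
(* Division by [ln 2] passes to base 2, where [e.-1] is at most the logarithm of [1 / eps]; and
   [5 * e + 23 <= 40 * e.-1] once [2 <= e]. *)
exists (40 / ln 2); first by rewrite divr_gt0.
move=> eps G eps0 eps2 oddG towG A alpha.
have [e e2 /andP[ee eeS]] := exists_dyadic eps0 eps2.
have {}towG : (tower_nat (5 * e + 23) <= #|G|)%N.
  apply: leq_trans towG; apply: leq_tower_nat.
  have ln_eps : (e.-1)%:R * ln 2 <= ln (1 / eps).
    rewrite mulr_natl -lnXn // ler_ln ?posrE ?exprn_gt0 ?divr_gt0 //.
    rewrite ler_pdivlMr // mulrC -ler_pdivlMr ?exprn_gt0 // mul1r -exprVn.
    exact: ltW.
  have h : (40 * e.-1)%:R <= 40 / ln 2 * ln (1 / eps).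
    by rewrite natrM -mulrA ler_pM2l // mulrC ler_pdivlMr.
  rewrite truncn_ge_nat; last by apply: le_trans h.
  apply: le_trans h; rewrite ler_nat; lia.
have n0 := card_zmod_gt0 R G.
have alphaE : alpha = 'E_x ind R A x.
  rewrite /alpha /density -sum1_card natr_sum big_mkcond; congr (_ / _).
  by apply: eq_bigr => x _; rewrite /ind; case: (x \in A).
have apE d : ap_density R A d * #|G|%:R = #|ap3_starts A d|%:R.
  rewrite /ap_density /avg divfK ?gt_eqF //.
  rewrite -sum1_card natr_sum [RHS]big_mkcond; apply: eq_bigr => x _.
  by rewrite inE /ind; do 3!case: (_ \in A); rewrite ?mulr1 ?mulr0 ?mul0r.
have [d0 d0n] : exists d : G, d != 0.
  have /card_gt1P[x [y [_ _ xy]]] : (1 < #|G|)%N.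
    by apply: leq_trans towG; apply: leq_trans (tower_nat_ge _); lia.
  by exists (x - y); rewrite subr_eq0.
(* A negative target is met by any nonzero difference; the increment argument needs a nonnegative
   one. *)
have [neg|nneg] := ltP (alpha ^+ 3 - eps) 0.
  exists d0 => //; apply: (@le_trans _ _ 0); last exact: ler0n.
  by rewrite nmulr_rle0.
have [|none] := boolP [exists d, (d != 0) && (alpha ^+ 3 - eps <= ap_density R A d)].
  case/existsP => d /andP[dn le]; exists d => //.
  by rewrite -apE ler_pM2r.
exfalso; rewrite alphaE in nneg none.
apply: (popular_difference oddG eps0 _ ee towG nneg); first by lra.
move=> d dn; rewrite leNgt; apply: contra none => lt; apply/existsP; exists d.
by rewrite dn ltW.
Qed.
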